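(* For $n\in\mathbb{N}$, the number of equivalence classes of the crossing-similarity relation $\sim_{cr}$ on $\mathcal{M}(n)$ equals $2^{n-2}\left(\binom{n}{2}+2\right)$.
   Context: A matching on $[2n]$ is a partition of $[2n]$ into $n$ two-element blocks (edges); $\mathcal{M}(n)$ is the set of such matchings. Edges $A,B$ cross if $\min A<\min B<\max A<\max B$ or vice versa; $cr(M)$ is the number of crossing pairs of edges. For $M\in\mathcal{M}(m)$, its children are the matchings obtained by choosing $x\in\{2,\dots,2m+2\}$, relabeling the vertices of $M$ order-preservingly by $\{2,\dots,2m+2\}\setminus\{x\}$ and adding the edge $\{1,x\}$. $\mathcal{T}(M,0)=\{M\}$ and $\mathcal{T}(M,l+1)$ is the set of children of members of $\mathcal{T}(M,l)$. $M\sim_{cr}N$ means that the multisets $cr(\mathcal{T}(M,l))=\{cr(P):P\in\mathcal{T}(M,l)\}$ and $cr(\mathcal{T}(N,l))$ are equal for every $l\ge 0$. *)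

(* Defs.v *)
From mathcomp Require Import all_boot all_order all_algebra.
From mathcomp Require Export boolp.

Set Implicit Arguments.
Unset Strict Implicit.
Unset Printing Implicit Defensive.

(* The vertex set [2n] = {1, ..., 2n} is represented by 'I_n.*2 = {0, ..., 2n-1},
   vertex i of the mathematics being i - 1 here. *)
Definition edges (n : nat) : finType := {set {set 'I_n.*2}}.

Definition matchings (n : nat) : {set edges n} :=
  [set M : edges n | partition M [set: 'I_n.*2] && [forall B in M, #|B| == 2]].

(* For nonempty A the defaults k and 0 are irrelevant. *)
Definition minv (k : nat) (A : {set 'I_k}) : nat := \big[minn/k]_(i in A) (i : nat).
Definition maxv (k : nat) (A : {set 'I_k}) : nat := \max_(i in A) (i : nat).

Definition crossing (k : nat) (A B : {set 'I_k}) : bool :=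
     [&& minv A < minv B, minv B < maxv A & maxv A < maxv B]
  || [&& minv B < minv A, minv A < maxv B & maxv B < maxv A].

(* Pairs of edges are unordered, hence counted as sets [set A; B]. *)
Definition cr (n : nat) (M : edges n) : nat :=
  #|[set [set A; B] | A in M, B in M & crossing A B]|.

(* The new edge {1, x} is [set ord0; lift ord0 y], where y : 'I_(m.*2.+1) encodes
   x = y + 2 in {2, ..., 2m+2}; i |-> lift ord0 (lift y i) is the increasing
   bijection from the old vertices onto the vertices other than 1 and x. *)
Definition child (m : nat) (M : edges m) (y : 'I_(m.*2.+1)) : edges m.+1 :=
  [set ord0; lift ord0 y]
    |: [set [set lift ord0 (lift y i) | i in B] | B : {set 'I_m.*2} in M].

Fixpoint tree (m : nat) (M : edges m) (l : nat) : {set edges (l + m)} :=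
  match l return {set edges (l + m)} with
  | 0 => [set M]
  | l'.+1 => [set child P y | P : edges (l' + m) in tree M l', y : 'I_((l' + m).*2.+1)]
  end.

Definition cr_tree (m : nat) (M : edges m) (l : nat) : seq nat :=
  [seq cr P | P <- enum (tree M l)].

(* perm_eq is equality of the underlying multisets. *)
Definition cr_similar (n : nat) (M N : edges n) : Prop :=
  forall l : nat, perm_eq (cr_tree M l) (cr_tree N l).

Definition cr_classes (n : nat) : {set {set edges n}} :=
  equivalence_partition (fun M N : edges n => `[< cr_similar M N >]) (matchings n).

Lemma child_matching (m : nat) (M : edges m) (y : 'I_(m.*2.+1)) :
  M \in matchings m -> child M y \in matchings m.+1.
Proof.
rewrite !inE => /andP[/and3P[/eqP covM trM nM0] /forall_inP M2].
set f := fun i : 'I_m.*2 => lift (ord0 : 'I_(m.*2.+2)) (lift y i).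
have f_inj : injective f by move=> i j /lift_inj/lift_inj.
have card_new : #|[set (ord0 : 'I_(m.*2.+2)); lift ord0 y]| = 2.
  by rewrite cards2 eq_sym.
have card_old (B : {set 'I_m.*2}) : #|f @: B| = #|B| by rewrite card_imset.
have C2 : forall B, B \in child M y -> #|B| = 2.
  move=> B; rewrite in_setU1 => /orP[/eqP-> //|/imsetP[B0 B0M ->]].
  by rewrite card_old; apply/eqP/M2.
have dis (B : {set 'I_m.*2}) : [disjoint [set (ord0 : 'I_(m.*2.+2)); lift ord0 y] & f @: B].
  rewrite -setI_eq0; apply/eqP/setP=> z; rewrite !inE; apply/negP=> /andP[hz /imsetP[i _ zE]].
  move: hz; rewrite zE => /orP[/eqP/esym|/eqP/lift_inj/esym] /eqP;
    by apply/negP/neq_lift.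
apply/andP; split; last by apply/forall_inP=> B /C2->.
apply/and3P; split.
- apply/eqP/setP=> z; rewrite inE; apply/bigcupP.
  case: (unliftP ord0 z) => [z' ->|->]; last first.
    by exists [set ord0; lift ord0 y]; rewrite ?set21 // setU11.
  case: (unliftP y z') => [i ->|->]; last first.
    by exists [set ord0; lift ord0 y]; rewrite ?set22 // setU11.
  have : i \in cover M by rewrite covM inE.
  case/bigcupP=> B BM iB; exists (f @: B); last exact: imset_f.
  by rewrite in_setU1 (imset_f (fun B : {set _} => f @: B)) // orbT.
- apply/trivIsetP=> A B; rewrite !in_setU1.
  case/orP=> [/eqP->|/imsetP[A0 A0M ->]]; case/orP=> [/eqP->|/imsetP[B0 B0M ->]].
  + by rewrite eqxx.
  + by move=> _; apply: dis.
  + by move=> _; rewrite disjoint_sym; apply: dis.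
  + move=> neq; rewrite -setI_eq0 -(imsetI (in2W f_inj)) imset_eq0 setI_eq0.
    by apply: (trivIsetP trM) => //; apply: contraNneq neq => ->.
- by apply/negP=> /C2; rewrite cards0.
Qed.

Lemma tree_matching (m : nat) (M : edges m) (l : nat) :
  M \in matchings m -> {subset tree M l <= matchings (l + m)}.
Proof.
move=> MM; elim: l => [|l IHl] P /=; first by rewrite inE => /eqP->.
by case/imset2P=> Q y /IHl QM _ ->; apply: child_matching.
Qed.

(* Main.v *)
Require Import Defs.
From mathcomp Require Import all_boot all_order all_algebra.
From mathcomp Require Import zify ring.

Set Implicit Arguments.
Unset Strict Implicit.
Unset Printing Implicit Defensive.

(* Let s_0, ..., s_2n be the heights of the Dyck path of M, i.e. the numbers of
   edges over the gaps between consecutive vertices.  Choosing the gap y adds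
   s_y crossings and replaces the heights by
   0, s_0 + 1, ..., s_y + 1, s_y, ..., s_2n.  In the variables x_i = q^(s_i) the
   sum over all children of a complete homogeneous symmetric polynomial h_k
   telescopes to a combination of h_1, ..., h_(k+1) in the x_i, with
   coefficients independent of M.  Hence M and N are similar if and only if
   they have the same crossing number and the same multiset of heights (the
   levels 0 and 1 of the trees give the converse).

   The multisets of heights are given by the compositions (a_1, ..., a_k) of n,
   where a_h is the number of up-steps reaching the level h, and the possible
   crossing numbers are then all the integers from 0 to the sum of the
   (h - 1) a_h.  Summing over the 2^(n-1) compositions gives the formula. *)

(** * Inserting an edge *)

(* [minn] has no neutral element, so the [\big[minn/k]] of [minv] is evaluated
   through the order. *)
Lemma minv2 k (a b : 'I_k) : a < b -> minv [set a; b] = a.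
Proof.
move=> ab; apply/eqP; rewrite eqn_leq; apply/andP; split.
  rewrite /minv -minEnat -leEnat.
  by apply: (Order.TotalTheory.bigmin_le_cond (T := nat) k (@nat_of_ord k)); rewrite set21.
apply: (big_ind (fun x => a <= x)) => [|x y ax ay|i].
- exact: ltnW.
- by rewrite leq_min ax.
- by rewrite !inE => /orP[]/eqP->; rewrite // ltnW.
Qed.

Lemma maxv2 k (a b : 'I_k) : a < b -> maxv [set a; b] = b.
Proof.
move=> ab; rewrite /maxv big_setU1 ?inE /=; last by rewrite -val_eqE /= ltn_eqF.
by rewrite big_set1 (maxn_idPr (ltnW ab)).
Qed.

Lemma card2_ordP k (B : {set 'I_k}) :
  #|B| = 2 -> exists a b : 'I_k, a < b /\ B = [set a; b].
Proof.
move=> /eqP/cards2P[a [b [ne ->]]].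
case: (ltngtP a b) => [ab|ba|/val_inj ab]; first by exists a, b.
  by exists b, a; rewrite setUC.
by rewrite ab eqxx in ne.
Qed.

Lemma matching_card2 m (M : edges m) B : M \in matchings m -> B \in M -> #|B| = 2.
Proof. by rewrite inE => /andP[_ /forall_inP M2] /M2/eqP. Qed.

Lemma matching_edgeP m (M : edges m) B : M \in matchings m -> B \in M ->
  exists a b : 'I_m.*2, a < b /\ B = [set a; b].
Proof. by move=> MM BM; apply/card2_ordP/(matching_card2 MM). Qed.

(** For [p <= q] the new edge opens in the old gap [p] and closes in the old gap [q], its ends
    becoming the vertices [p] and [q.+1]. Children have [p = ord0]; general [p] serves to realize
    prescribed crossing numbers. *)
Definition insert_edge m (M : edges m) (p : 'I_(m.*2.+2)) (q : 'I_(m.*2.+1)) :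
    edges m.+1 :=
  [set p; lift p q]
    |: [set [set lift p (lift q i) | i in B] | B : {set 'I_m.*2} in M].

Section Insert.
Variables (m : nat) (p : 'I_(m.*2.+2)) (q : 'I_(m.*2.+1)).
Let f := fun i : 'I_m.*2 => lift p (lift q i).
Let E := [set p; lift p q].

Lemma insert_emb_inj : injective f.
Proof. by move=> i j /lift_inj/lift_inj. Qed.

Lemma insert_edge_disjoint (B : {set 'I_m.*2}) : [disjoint E & f @: B].
Proof.
rewrite -setI_eq0; apply/eqP/setP=> z; rewrite !inE.
apply/negP=> /andP[hz /imsetP[i _ zE]].
move: hz; rewrite zE => /orP[/eqP/esym|/eqP/lift_inj/esym] /eqP;
  by apply/negP/neq_lift.
Qed.

Lemma insert_edge_fresh (M : edges m) : E \notin [set f @: B | B : {set 'I_m.*2} in M].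
Proof.
apply/imsetP=> -[B _ EB]; have := insert_edge_disjoint B.
rewrite -EB -setI_eq0 setIid => /eqP/setP/(_ p).
by rewrite !inE eqxx.
Qed.

Lemma insert_edge_matching (M : edges m) :
  M \in matchings m -> insert_edge M p q \in matchings m.+1.
Proof.
move=> MM; move: (MM); rewrite !inE => /andP[/and3P[/eqP covM trM nM0] _].
have C2 : forall B, B \in insert_edge M p q -> #|B| = 2.
  move=> B; rewrite in_setU1 => /orP[/eqP-> //|/imsetP[B0 B0M ->]].
    by rewrite cards2 neq_lift.
  by rewrite card_imset ?(matching_card2 MM) //; apply: insert_emb_inj.
apply/andP; split; last by apply/forall_inP=> B /C2->.
apply/and3P; split.
- apply/eqP/setP=> z; rewrite inE; apply/bigcupP.
  case: (unliftP p z) => [z' ->|->]; last first.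
    by exists E; rewrite ?set21 // setU11.
  case: (unliftP q z') => [i ->|->]; last first.
    by exists E; rewrite ?set22 // setU11.
  have : i \in cover M by rewrite covM inE.
  case/bigcupP=> B BM iB; exists (f @: B); last exact: imset_f.
  by rewrite in_setU1 (imset_f (fun B : {set _} => f @: B)) // orbT.
- apply/trivIsetP=> A B; rewrite !in_setU1.
  case/orP=> [/eqP->|/imsetP[A0 A0M ->]]; case/orP=> [/eqP->|/imsetP[B0 B0M ->]].
  + by rewrite eqxx.
  + by move=> _; apply: insert_edge_disjoint.
  + by move=> _; rewrite disjoint_sym; apply: insert_edge_disjoint.
  + move=> neq; rewrite -setI_eq0 -(imsetI (in2W insert_emb_inj)) imset_eq0 setI_eq0.
    by apply: (trivIsetP trM) => //; apply: contraNneq neq => ->.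
- by apply/negP=> /C2; rewrite cards0.
Qed.

Lemma big_insert_edge (R : Type) (idx : R) (op : Monoid.com_law idx)
    (M : edges m) (G : {set 'I_m.+1.*2} -> R) :
  \big[op/idx]_(B in insert_edge M p q) G B
    = op (G E) (\big[op/idx]_(B in M) G (f @: B)).
Proof.
rewrite big_setU1 ?insert_edge_fresh // big_imset //.
by move=> A B _ _; apply: imset_inj; apply: insert_emb_inj.
Qed.

Hypothesis pq : p <= q.

Lemma insert_embE (i : 'I_m.*2) : f i = i + (p <= i) + (q <= i) :> nat.
Proof. rewrite /= /bump; lia. Qed.

Lemma minv_new_edge : minv E = p.
Proof. rewrite minv2 //= /bump; lia. Qed.

Lemma maxv_new_edge : maxv E = q.+1.
Proof. by rewrite maxv2 /= /bump pq. Qed.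

Lemma insert_emb_lt (a b : 'I_m.*2) : a < b -> f a < f b.
Proof. rewrite !insert_embE; lia. Qed.

Lemma minv_insert (B : {set 'I_m.*2}) : #|B| = 2 ->
  minv (f @: B) = minv B + (p <= minv B) + (q <= minv B).
Proof.
case/card2_ordP => a [b [ab ->]].
by rewrite imsetU1 imset_set1 (minv2 ab) (minv2 (insert_emb_lt ab)) insert_embE.
Qed.

Lemma maxv_insert (B : {set 'I_m.*2}) : #|B| = 2 ->
  maxv (f @: B) = maxv B + (p <= maxv B) + (q <= maxv B).
Proof.
case/card2_ordP => a [b [ab ->]].
by rewrite imsetU1 imset_set1 (maxv2 ab) (maxv2 (insert_emb_lt ab)) insert_embE.
Qed.

End Insert.

Lemma child_insert m (M : edges m) y : child M y = insert_edge M ord0 y.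
Proof. by []. Qed.

(** * Crossings and heights *)

(** Oriented by the minima, so that a double sum over edges counts each unordered crossing pair
    exactly once. *)
Definition ocrossing k (A B : {set 'I_k}) : bool :=
  [&& minv A < minv B, minv B < maxv A & maxv A < maxv B].

Lemma crE n (M : edges n) :
  cr M = \sum_(A in M) \sum_(B in M) ocrossing A B.
Proof.
pose X := [set u : {set 'I_n.*2} * {set 'I_n.*2} |
           [&& u.1 \in M, u.2 \in M & ocrossing u.1 u.2]].
have -> : cr M = #|[set [set u.1; u.2] | u in X]|.
  apply: eq_card => C; apply/imset2P/imsetP.
    move=> [A B AM]; rewrite inE => /andP[BM /orP[c|c]] ->.
      by exists (A, B); rewrite // inE /= AM BM.
    by exists (B, A); rewrite 1?setUC // inE /= AM BM.
  move=> [[A B]]; rewrite inE /= => /and3P[AM BM c] ->.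
  by exists A B => //; rewrite inE BM /crossing; move: c; rewrite /ocrossing => ->.
rewrite card_in_imset; last first.
  move=> [A B] [C D]; rewrite !inE /= => /and3P[_ _ cAB] /and3P[_ _ cCD] eqS.
  have ltAB : minv A < minv B by case/and3P: cAB.
  have ltCD : minv C < minv D by case/and3P: cCD.
  have : A \in [set C; D] by rewrite -eqS set21.
  have : B \in [set C; D] by rewrite -eqS set22.
  have : D \in [set A; B] by rewrite eqS set22.
  rewrite !inE => /orP[]/eqP hD /orP[]/eqP hB /orP[]/eqP hA; subst=> //; lia.
rewrite pair_big_dep /= -sum1_card big_mkcond [RHS]big_mkcond /=.
by apply: eq_bigr => -[A B] _; rewrite inE /=; case: (A \in M); case: (B \in M); case: ocrossing.
Qed.

(* [ht M g] is the number of edges over the gap before vertex [g]; [hts M] lists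
   the heights of the Dyck path of [M]. *)
Definition ht n (M : edges n) (g : nat) : nat :=
  \sum_(B in M) (minv B < g <= maxv B).

Definition hts n (M : edges n) : seq nat := [seq ht M g | g <- iota 0 n.*2.+1].

Lemma size_hts n (M : edges n) : size (hts M) = n.*2.+1.
Proof. by rewrite size_map size_iota. Qed.

Lemma nth_hts n (M : edges n) g : g < n.*2.+1 -> nth 0 (hts M) g = ht M g.
Proof. by move=> gn; rewrite (nth_map 0) ?size_iota // nth_iota. Qed.

Lemma ht0 n (M : edges n) : ht M 0 = 0.
Proof. by rewrite /ht big1. Qed.

Section InsertStat.
Variables (m : nat) (M : edges m) (p : 'I_(m.*2.+2)) (q : 'I_(m.*2.+1)).
Hypotheses (MM : M \in matchings m) (pq : p <= q).

Lemma ht_insert g : ht (insert_edge M p q) g =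
  if g <= p then ht M g else if g <= q.+1 then (ht M g.-1).+1 else ht M g.-2.
Proof.
rewrite {1}/ht big_insert_edge /= minv_new_edge // maxv_new_edge //.
have minmax B : B \in M -> minv B < maxv B.
  by case/(matching_edgeP MM) => a [b [ab ->]]; rewrite minv2 ?maxv2.
case: (leqP g p) => gp; last case: (leqP g q.+1) => gq; rewrite ?(add0n, add1n);
  [|congr S|]; apply: eq_bigr => B BM; have := minmax B BM;
  rewrite minv_insert ?maxv_insert ?(matching_card2 MM) //; lia.
Qed.

(** By the hypothesis an old edge over gap [p] is still over gap [q], so the edges crossing the new
    one are those over [q] but not over [p]. *)
Lemma cr_insert : (forall B, B \in M -> ~~ [&& minv B < p, p <= maxv B & maxv B < q]) ->
  cr (insert_edge M p q) + ht M p = cr M + ht M q.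
Proof.
move=> H; rewrite !crE big_insert_edge /= big_insert_edge /=.
have -> : ocrossing [set p; lift p q] [set p; lift p q] = false by rewrite /ocrossing ltnn.
rewrite add0n; under [X in _ + X + _]eq_bigr => A AM do rewrite big_insert_edge /=.
rewrite big_split /= /ht addnA addnAC addnC; congr (_ + _).
  apply: eq_bigr => A AM; apply: eq_bigr => B BM.
  by rewrite /ocrossing !minv_insert ?maxv_insert ?(matching_card2 MM) //; lia.
rewrite -!big_split /=; apply: eq_bigr => B BM; have := H B BM.
have : minv B < maxv B.
  by case/(matching_edgeP MM): BM => a [b [ab ->]]; rewrite minv2 ?maxv2.
rewrite /ocrossing minv_insert ?maxv_insert ?(matching_card2 MM) //.
rewrite minv_new_edge // maxv_new_edge //; lia.
Qed.

(** Each new vertex splits its gap in two, which is why [p] and [q] each occur in two consecutive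
    segments. *)
Lemma hts_insert : hts (insert_edge M p q) =
  [seq ht M g | g <- iota 0 p.+1] ++ [seq (ht M g).+1 | g <- iota p (q - p).+1]
    ++ [seq ht M g | g <- iota q (m.*2.+1 - q)].
Proof.
have -> : m.*2.+1 - q = (m.*2 - q).+1 by have := ltn_ord q; lia.
have dE : m.+1.*2.+1 = p.+1 + ((q - p).+1 + (m.*2 - q).+1).
  by have := ltn_ord q; lia.
rewrite /hts dE !iotaD !map_cat; congr (_ ++ _); last congr (_ ++ _).
- by apply/eq_in_map=> g; rewrite mem_iota => /andP[_ gp]; rewrite ht_insert ifT //; lia.
- rewrite add0n -[p.+1]add1n iotaDl -map_comp; apply/eq_in_map=> g; rewrite mem_iota => gp.
  by rewrite /= add1n ht_insert ifF ?ifT //; lia.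
- have -> : 0 + p.+1 + (q - p).+1 = 2 + q by lia.
  rewrite iotaDl -map_comp; apply/eq_in_map=> g; rewrite mem_iota => gq.
  by rewrite /= ht_insert !ifF //; lia.
Qed.

End InsertStat.

Lemma cr_child m (M : edges m) y : M \in matchings m ->
  cr (child M y) = cr M + ht M y.
Proof.
by move=> MM; have := @cr_insert m M ord0 y MM isT (fun _ _ => isT); rewrite ht0 addn0.
Qed.

Lemma hts_child m (M : edges m) (y : 'I_(m.*2.+1)) : M \in matchings m ->
  hts (child M y) = 0 :: map S (take y.+1 (hts M)) ++ drop y (hts M).
Proof.
move=> MM; rewrite child_insert hts_insert // subn0.
rewrite /hts -map_take -map_drop take_iota drop_iota add0n -map_comp.
rewrite (minn_idPl _) //.
have -> : [seq ht M g | g <- iota 0 (@ord0 m.*2.+1).+1] = [:: 0] by rewrite /= ht0.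
by [].
Qed.

Section Ring.
Import GRing.Theory.
Local Open Scope ring_scope.

(** * Complete homogeneous symmetric polynomials *)

Section Complete.
Variable R : comNzRingType.
Implicit Types (x y a b q : R) (s t p : seq R) (j k : nat).

(** The complete homogeneous symmetric polynomial of degree [k] at the values [s], expanded by the
    exponent of the first variable. *)
Fixpoint hsym s k : R :=
  if s is x :: s' then \sum_(i < k.+1) x ^+ i * hsym s' (k - i) else (k == 0)%:R.

Lemma hsym0 s : hsym s 0 = 1.
Proof. by elim: s => //= x s IHs; rewrite big_ord1 mul1r IHs. Qed.

Lemma hsymS x s k : hsym (x :: s) k.+1 = hsym s k.+1 + x * hsym (x :: s) k.
Proof.
rewrite /= big_ord_recl mul1r subn0; congr (_ + _); rewrite mulr_sumr.
by apply: eq_bigr => i _; rewrite /= exprS mulrA.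
Qed.

(** Peel off both variables with [hsymS]; the value in the previous degree can be peeled from [x]
    or, by induction, from [y], and using one form on each side makes them agree. *)
Lemma hsym_swap x y s k : hsym (x :: y :: s) k = hsym (y :: x :: s) k.
Proof.
elim/ltn_ind: k => -[|[|k]] IHk; first by rewrite !hsym0.
  by rewrite !hsymS !hsym0; ring.
have eqx : hsym (x :: y :: s) k.+1 = hsym (y :: s) k.+1 + x * hsym (x :: y :: s) k.
  exact: hsymS.
have eqy : hsym (x :: y :: s) k.+1 = hsym (x :: s) k.+1 + y * hsym (x :: y :: s) k.
  by rewrite IHk // hsymS (IHk k).
rewrite (hsymS x) (hsymS y (x :: s)) -(IHk k.+1) // (hsymS y) (hsymS x s).
by rewrite {1}eqy eqx; ring.
Qed.

Lemma eq_hsym_cons x s t : hsym s =1 hsym t -> hsym (x :: s) =1 hsym (x :: t).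
Proof. by move=> st k /=; apply: eq_bigr => i _; rewrite st. Qed.

Lemma hsym_catCA x s t : hsym (s ++ x :: t) =1 hsym (x :: s ++ t).
Proof.
elim: s => // y s IHs k.
by rewrite !cat_cons (eq_hsym_cons y IHs) hsym_swap.
Qed.

Lemma perm_hsym s t : perm_eq s t -> hsym s =1 hsym t.
Proof.
elim: s t => [|x s IHs] t.
  by move=> /perm_size; case: t.
move=> st; have xt : x \in t by rewrite -(perm_mem st) mem_head.
case/splitPr: xt st => t1 t2 st k.
rewrite hsym_catCA; apply/eq_hsym_cons/IHs.
by rewrite -(perm_cons x) (perm_trans st) // (perm_catCA t1 [:: x] t2).
Qed.

Lemma hsym_scale q s k : hsym [seq q * x | x <- s] k = q ^+ k * hsym s k.
Proof.
elim: s k => [|x s IHs] k /=; first by case: k => [|k]; rewrite ?mul1r ?mulr0.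
rewrite mulr_sumr; apply: eq_bigr => i _; rewrite IHs exprMn.
have -> : q ^+ k = q ^+ i * q ^+ (k - i) by rewrite -exprD subnKC // -ltnS.
ring.
Qed.

(** The divided difference of h_(k+1): compare the two ways of peeling one variable off h_(k+1)(a,
    b, s). *)
Lemma hsym_diff a b s k :
  (a - b) * hsym (a :: b :: s) k = hsym (a :: s) k.+1 - hsym (b :: s) k.+1.
Proof.
have eqa : hsym (a :: b :: s) k.+1 = hsym (b :: s) k.+1 + a * hsym (a :: b :: s) k.
  exact: hsymS.
have eqb : hsym (a :: b :: s) k.+1 = hsym (a :: s) k.+1 + b * hsym (a :: b :: s) k.
  by rewrite hsym_swap hsymS (hsym_swap b a).
by apply/eqP; rewrite mulrBl subr_eq addrAC eq_sym subr_eq -eqb eqa addrC.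
Qed.

(** [take i.+1] and [drop i] overlap, so the [i]-th list contains both q x_i and x_i. Their
    difference is (q - 1) x_i, and [hsym_diff] turns the term into the change caused by scaling x_i.
    The prefix [p] collects the variables already scaled. *)
Lemma hsym_telescope q p s k :
  (q - 1) * (\sum_(i < size s) s`_i *
     hsym (p ++ [seq q * x | x <- take i.+1 s] ++ drop i s) k)
  = hsym (p ++ [seq q * x | x <- s]) k.+1 - hsym (p ++ s) k.+1.
Proof.
elim: s p => [|x s IHs] p /=; first by rewrite big_ord0 mulr0 subrr.
rewrite big_ord_recl /= take0 mulrDr.
under eq_bigr => i _ do rewrite /= -cat_rcons.
rewrite IHs cat_rcons.
have -> : (q - 1) * (x * hsym (p ++ [:: q * x, x & s]) k) =
  hsym (p ++ q * x :: s) k.+1 - hsym (p ++ x :: s) k.+1.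
  have /perm_hsym -> : perm_eq (p ++ [:: q * x, x & s]) (q * x :: x :: p ++ s).
    by rewrite (perm_catCA p [:: q * x; x] s).
  by rewrite !hsym_catCA -hsym_diff; ring.
by rewrite cat_rcons addrC; ring.
Qed.

Lemma hsym1 s k : hsym (1 :: s) k = \sum_(i < k.+1) hsym s i.
Proof.
rewrite /= (reindex_inj rev_ord_inj) /=; apply: eq_bigr => i _.
by rewrite expr1n mul1r subSS subKn // -ltnS.
Qed.

(* The coefficients on the right do not depend on [s]: this makes the tree sums
   functions of the multiset of heights. *)
Lemma hsym_children q s k :
  (q - 1) * (\sum_(i < size s) s`_i *
     hsym (1 :: [seq q * x | x <- take i.+1 s] ++ drop i s) k)
  = \sum_(j < k.+1) (q ^+ j.+1 - 1) * hsym s j.+1.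
Proof.
under eq_bigr => i _ do rewrite hsym1 mulr_sumr.
rewrite exchange_big mulr_sumr; apply: eq_bigr => j _.
by rewrite (hsym_telescope q [::]) hsym_scale mulrBl mul1r.
Qed.

End Complete.

(** * Crossing generating functions of the trees *)

(** The edge at [ord0] recovers [y], and deleting it recovers [M]. Hence a tree level, though a set,
    can be summed over pairs (parent, gap). *)
Lemma child_inj m : injective (fun u : edges m * 'I_(m.*2.+1) => child u.1 u.2).
Proof.
move=> [M y] [N z] /= eqMN.
have yz : y = z.
  have : [set ord0; lift ord0 y] \in child N z by rewrite -eqMN setU11.
  rewrite in_setU1 => /orP[/eqP/setP/(_ (lift ord0 y))|/imsetP[B _ /setP/(_ ord0)]].
    by rewrite !inE eqxx orbT /= => /esym/eqP/lift_inj.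
  by rewrite !inE eqxx => /esym/imsetP[].
subst z; congr (_, _).
have := congr1 (fun S => S :\ [set ord0; lift ord0 y]) eqMN.
rewrite /child !setU1K ?insert_edge_fresh //; apply: imset_inj.
by apply: imset_inj; apply: insert_emb_inj.
Qed.

(** The weight [F] on heights makes a recursion on levels possible: [tree_sumS] absorbs the last
    level into [F]. *)
Definition tree_sum m (M : edges m) l (F : seq nat -> {poly int}) : {poly int} :=
  \sum_(P in tree M l) 'X^(cr P) * F (hts P).

Lemma tree_sumS m (M : edges m) l F : M \in matchings m ->
  tree_sum M l.+1 F = tree_sum M l (fun s =>
    \sum_(i < size s) 'X^(nth 0%N s i) * F (0%N :: map S (take i.+1 s) ++ drop i s)).
Proof.
move=> MM; rewrite /tree_sum [tree M l.+1]/=.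
have -> : [set child P y | P : edges (l + m) in tree M l, y : 'I_((l + m).*2.+1)] =
   [set child u.1 u.2 | u in setX (tree M l) [set: 'I_((l + m).*2.+1)]].
  apply/setP=> Q; apply/imset2P/imsetP => [[P y Pt _ ->]|[[P y]]].
    by exists (P, y); rewrite // in_setX Pt inE.
  by rewrite in_setX => /andP[Pt _] ->; exists P y.
rewrite big_imset; last by move=> u v _ _ /child_inj.
transitivity (\sum_(P in tree M l) \sum_(y < (l + m).*2.+1)
    'X^(cr (child P y)) * F (hts (child P y))).
  by rewrite pair_big_dep /=; apply: eq_bigl => u; rewrite inE in_setT.
apply: eq_bigr => P Pt; have PM := tree_matching MM Pt.
rewrite size_hts mulr_sumr; apply: eq_bigr => y _.
by rewrite cr_child // hts_child // nth_hts // exprD mulrA.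
Qed.

Definition gf (s : seq nat) : {poly int} := \sum_(c <- s) 'X^c.

Lemma gf_perm s t : gf s = gf t <-> perm_eq s t.
Proof.
split=> [eq_st|]; last exact: perm_big.
have coef_gf u k : (gf u)`_k = (count_mem k u)%:R.
  rewrite /gf coef_sum; elim: u => [|c u IHu]; first by rewrite big_nil.
  by rewrite big_cons IHu /= coefXn natrD eq_sym.
apply/allP=> k _ /=; apply/eqP.
have := congr1 (fun P : {poly int} => P`_k) eq_st.
by rewrite !coef_gf !natz => -[].
Qed.

Lemma gf_cr_tree m (M : edges m) l : gf (cr_tree M l) = tree_sum M l (fun=> 1).
Proof.
rewrite /gf /cr_tree big_map big_enum /=.
by apply: eq_bigr => P _; rewrite mulr1.
Qed.

(** [hsym_children] at each node expresses level [l.+1] in degree [k] by level [l] in degrees 1 to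
    [k.+1], hence the induction over all [k] at once. The factor ['X - 1] cancels in the domain
    [{poly int}]. *)
Lemma tree_sum_hsym m (M N : edges m) l k : M \in matchings m -> N \in matchings m ->
  cr M = cr N -> perm_eq (hts M) (hts N) ->
  tree_sum M l (fun s => hsym [seq 'X^a | a <- s] k)
    = tree_sum N l (fun s => hsym [seq 'X^a | a <- s] k).
Proof.
move=> MM NN eq_cr eq_hts; elim: l k => [|l IHl] k.
  rewrite /tree_sum !big_set1 eq_cr; congr (_ * _).
  by apply: perm_hsym; apply: perm_map.
have nz : 'X - 1 != 0 :> {poly int} by rewrite -polyC1 polyXsubC_eq0.
have step (P : edges m) : P \in matchings m ->
    ('X - 1) * tree_sum P l.+1 (fun s => hsym [seq 'X^a | a <- s] k) =
    \sum_(j < k.+1) ('X ^+ j.+1 - 1) * tree_sum P l (fun s => hsym [seq 'X^a | a <- s] j.+1).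
  move=> PP; rewrite tree_sumS // /tree_sum mulr_sumr.
  under [RHS]eq_bigr => j _ do rewrite mulr_sumr.
  rewrite [RHS]exchange_big; apply: eq_bigr => Q _.
  rewrite mulrCA; under [RHS]eq_bigr => j _ do rewrite mulrCA.
  rewrite -mulr_sumr -hsym_children (size_map (fun a => 'X^a) (hts Q)); congr (_ * (_ * _)).
  apply: eq_bigr => i _; rewrite (nth_map 0%N 0 (fun a => 'X^a)) //; congr (_ * hsym _ _).
  rewrite map_cons map_cat -!map_take -!map_drop -!map_comp expr0; congr (_ :: _ ++ _).
  by apply: eq_map => a /=; rewrite exprS.
by apply: (mulfI nz); rewrite !step //; apply: eq_bigr => j _; rewrite IHl.
Qed.

Lemma cr_similarP m (M N : edges m) : M \in matchings m -> N \in matchings m ->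
  cr_similar M N <-> cr M = cr N /\ perm_eq (hts M) (hts N).
Proof.
move=> MM NN; split=> [sim|[eq_cr eq_hts] l].
  have eq_cr : cr M = cr N.
    have := sim 0; rewrite /cr_tree /= !enum_set1 /= => /perm_mem/(_ (cr M)).
    by rewrite !inE eqxx => /esym/eqP.
  (* The children of [M] have crossing numbers [cr M] plus a height; cancelling the common power of
     ['X] leaves the generating function of the heights. *)
  split=> //; have /gf_perm := sim 1%N.
  rewrite !gf_cr_tree !tree_sumS // /tree_sum !big_set1 eq_cr => /(mulfI (monic_neq0 (monicXn _ _))).
  have gfE s : \sum_(i < size s) 'X^(nth 0%N s i) * 1 = gf s.
    by rewrite /gf (big_nth 0%N) big_mkord; apply: eq_bigr => i _; rewrite mulr1.
  by rewrite !gfE => /gf_perm.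
(* Degree 0 suffices here, since h_0 = 1. *)
apply/gf_perm; rewrite !gf_cr_tree; have := tree_sum_hsym l 0 MM NN eq_cr eq_hts.
by rewrite /tree_sum; under eq_bigr do rewrite hsym0; under [RHS]eq_bigr do rewrite hsym0.
Qed.

End Ring.

(** * Every matching is a child *)

(** Delete the edge at [ord0] and pull the others back along the increasing embedding. This gives
    induction on matchings. *)
Lemma matching_child m (M : edges m.+1) : M \in matchings m.+1 ->
  exists P y, P \in matchings m /\ M = child P y.
Proof.
move=> MM; move: (MM); rewrite !inE => /andP[/and3P[/eqP covM trM _] _].
have : ord0 \in cover M by rewrite covM inE.
case/bigcupP=> B0 B0M; have [a [b [ab defB0]]] := matching_edgeP MM B0M.
rewrite defB0 !inE => /orP[]/eqP e0; last by move: ab; rewrite -e0 ltn0.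
have [y by_] : exists y : 'I_(m.*2.+1), b = lift ord0 y.
  by case: (unliftP ord0 b) ab => [y ->|->]; [exists y | rewrite ltn0].
rewrite -e0 by_ in defB0; move: a b ab e0 by_ => _ _ _ _ _.
pose f := fun i : 'I_m.*2 => lift (ord0 : 'I_(m.*2.+2)) (lift y i).
have f_inj : injective f by apply: insert_emb_inj.
have fK (B : {set 'I_m.+1.*2}) : B \in M :\ B0 -> f @: (f @^-1: B) = B.
  rewrite in_setD1 => /andP[BB0 BM].
  have /disjoint_setI0 dis : [disjoint B & B0] by apply: (trivIsetP trM).
  apply/setP=> z; apply/imsetP/idP => [[i]|zB]; first by rewrite inE => ? ->.
  have : z \notin B0 by apply/negP=> zB0; move/setP/(_ z): dis; rewrite !inE zB zB0.
  rewrite defB0 !inE negb_or => /andP[].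
  case: (unliftP ord0 z) zB => [z' ->|->] // zB _.
  case: (unliftP y z') zB => [i ->|->]; last by rewrite eqxx.
  by move=> zB _; exists i; rewrite ?inE.
exists [set f @^-1: B | B : {set 'I_m.+1.*2} in M :\ B0], y; split; last first.
  apply/setP=> C; rewrite /child in_setU1 -defB0 -imset_comp.
  have -> : [set ((fun B : {set 'I_m.*2} => f @: B) \o (fun B : {set 'I_m.+1.*2} => f @^-1: B)) B
             | B in M :\ B0] = M :\ B0.
    rewrite -[RHS](imset_id (M :\ B0)).
    by apply: eq_in_imset => B BM; rewrite /= fK.
  by rewrite in_setD1; case: eqP => // ->.
have C2 C : C \in [set f @^-1: B | B : {set 'I_m.+1.*2} in M :\ B0] -> #|C| = 2.
  case/imsetP=> B BM ->; rewrite -(card_imset _ f_inj) fK //.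
  by apply: (matching_card2 MM); move: BM; rewrite in_setD1 => /andP[].
rewrite inE; apply/andP; split; last by apply/forall_inP=> C /C2 ->.
apply/and3P; split.
- apply/eqP/setP=> i; rewrite inE; apply/bigcupP.
  have : f i \in cover M by rewrite covM inE.
  case/bigcupP=> B BM iB; exists (f @^-1: B); last by rewrite inE.
  apply: imset_f; rewrite in_setD1 BM andbT; apply: contraTneq iB => ->.
  rewrite defB0 !inE negb_or; apply/andP; split.
    by rewrite eq_sym neq_lift.
  by apply/eqP=> /lift_inj/esym/eqP; apply/negP/neq_lift.
- apply/trivIsetP=> _ _ /imsetP[A AM ->] /imsetP[B BM ->] AB.
  rewrite -setI_eq0 -preimsetI.
  have : [disjoint A & B].
    move: AM BM; rewrite !in_setD1 => /andP[_ AM] /andP[_ BM].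
    by apply: (trivIsetP trM) => //; apply: contraNneq AB => ->.
  by rewrite -setI_eq0 => /eqP ->; rewrite preimset0.
- by apply/negP=> /C2; rewrite cards0.
Qed.

Lemma matching0 (M : edges 0) : M \in matchings 0 -> M = set0.
Proof.
move=> MM; apply/setP=> B; rewrite inE; apply/negP=> BM.
by have [[]] := matching_edgeP MM BM.
Qed.

(** * Heights of a matching *)

Definition unit_step (a b : nat) := (b == a.+1) || (a == b.+1).

(** The first edge of a child adds an up-step in front and a down-step inside gap [y]; all other
    steps are copies of old ones. *)
Lemma ht_walk n (M : edges n) : M \in matchings n ->
  ht M n.*2 = 0 /\ forall g, g < n.*2 -> unit_step (ht M g) (ht M g.+1).
Proof.
elim: n M => [|n IHn] M MM.
  by rewrite (matching0 MM) /ht big_set0.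
have [P [y [PM ->]]] := matching_child MM; have [P0 Pstep] := IHn _ PM.
rewrite child_insert; split=> [|g gn].
  rewrite ht_insert //=; have := ltn_ord y; rewrite /= => yn.
  rewrite ifF; last by lia.
  by rewrite P0.
rewrite !ht_insert //= /unit_step leqn0.
case: g gn => [|g] gn /=; first by rewrite !ht0.
have /= := ltn_ord y => yn; rewrite !ltnS; case: (ltngtP g y) => [gy|yg|->].
- by rewrite !eqSS; apply: Pstep; lia.
- by case: g gn yg => // g gn yg /=; apply: Pstep; lia.
- by rewrite eqxx orbT.
Qed.

Lemma ht_le n (M : edges n) g : M \in matchings n -> g <= n.*2 -> ht M g <= g.
Proof.
case/ht_walk => _ step; elim: g => [|g IHg] gn; first by rewrite ht0.
have := IHg (ltnW gn); have := step g gn; rewrite /unit_step; lia.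
Qed.

(** A child at gap [y] gains s_y crossings while the sum of the heights grows by s_y + y + 1, and
    s_y <= y. *)
Lemma cr_le_hts n (M : edges n) : M \in matchings n -> (cr M).*2 + n <= sumn (hts M).
Proof.
elim: n M => [|n IHn] M MM.
  by rewrite (matching0 MM) crE big_set0.
have [P [y [PM ->]]] := matching_child MM; have IH := IHn _ PM.
rewrite cr_child // hts_child //; have := ht_le PM (ltn_ord y : y <= n.*2).
have sumnS s : sumn (map S s) = sumn s + size s.
  by elim: s => //= a s ->; lia.
rewrite -cat1s !sumn_cat sumnS [sumn [:: 0]]/= size_take size_hts.
have -> : (if y.+1 < n.*2.+1 then y.+1 else n.*2.+1) = y.+1.
  by have := ltn_ord y; case: (ltnP y.+1); lia.
rewrite (take_nth 0) ?size_hts // nth_hts // sumn_rcons.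
move: IH; rewrite -{1}(cat_take_drop y (hts P)) sumn_cat; lia.
Qed.

(** The heights of a Dyck path whose up-steps reach the levels [K]: the start, the ends of the
    up-steps, and the ends of the down-steps, which are matched with up-steps of the same level. *)
Definition profile (K : seq nat) : seq nat := 0 :: K ++ map predn K.

(* [K] lists the levels reached by the up-steps.  For each level up to [h N], one
   up-step is not undone by a down-step; [iota 0 (h N)] makes up for these. *)
Lemma walk_profile (h : nat -> nat) N :
  h 0 = 0 -> (forall g, g < N -> unit_step (h g) (h g.+1)) ->
  exists K, [/\ perm_eq (map h (iota 0 N.+1) ++ iota 0 (h N)) (profile K),
    0 \notin K, {in K, forall x, 1 < x -> x.-1 \in K}
    & forall x, 0 < x <= h N -> x \in K].
Proof.
move=> h0; elim: N => [|N IHN] step.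
  by exists [::]; split=> // [|x]; rewrite /= h0 //; lia.
have [g gN|K [permK K0 Kdown Kfull]] := IHN; first by apply: step; lia.
have iotaSr n : iota 0 n.+1 = iota 0 n ++ [:: n] by rewrite -addn1 iotaD.
have := step N (ltnSn N) => /orP[]/eqP hN; last first.
  (* A down-step to [h N.+1] moves this value from the correcting [iota] to the heights. *)
  exists K; split=> // [|x xN]; last by apply: Kfull; lia.
  apply: perm_trans permK; apply/permP=> a.
  by rewrite hN (iotaSr N.+1) (iotaSr (h N.+1)) map_cat !count_cat /=; lia.
(* An up-step adds the height [h N.+1], and its predecessor [h N] enters the correcting [iota]. *)
exists (h N.+1 :: K); split.
- apply/permP=> a; have /permP/(_ a) := permK.
  rewrite hN (iotaSr N.+1) (iotaSr (h N)) map_cat !count_cat /= !count_cat /= hN.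
  lia.
- by rewrite inE negb_or K0 hN.
- move=> x; rewrite !inE => /orP[/eqP->|xK] x1; last by rewrite Kdown ?orbT.
  by rewrite hN Kfull ?orbT //; lia.
- move=> x xN; rewrite inE; case: eqP => //= xh; apply: Kfull; lia.
Qed.

(** Encodes a composition of [(size b).+1] by bits: a true bit starts the next level, and the parts
    are the multiplicities of the entries. *)
Fixpoint levels (k : nat) (b : seq bool) : seq nat :=
  if b is x :: b' then k :: levels (k + x) b' else [:: k].

Lemma size_levels k b : size (levels k b) = (size b).+1.
Proof. by elim: b k => //= x b IHb k; rewrite IHb. Qed.

Lemma sumn_levels k b : sumn (levels k b) = k * (size b).+1 + sumn (levels 0 b).
Proof.
elim: b k => [|x b IHb] k /=; first by lia.
rewrite IHb [in RHS]IHb; nia.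
Qed.

Lemma levels_inj k : injective (levels k).
Proof.
have head b j : exists t, levels j b = j :: t.
  by case: b => [|x b]; eexists.
move=> b; elim: b k => [|x b IHb] k [|y c] //= [].
- by case: (head c (k + y)) => t ->.
- by case: (head b (k + x)) => t ->.
move=> eqL; have exy : x = y.
  have [t e1] := head b (k + x); have [u e2] := head c (k + y).
  by move: eqL; rewrite e1 e2 => -[]; case: x {e1}; case: y {e2}; lia.
by subst y; rewrite (IHb _ _ eqL).
Qed.

Lemma path_levels k b : path leq k (levels k b).
Proof.
elim: b k => [|x b IHb] k /=; rewrite leqnn //=.
by apply: path_le (IHb _); [exact: leq_trans | rewrite leq_addr].
Qed.

Lemma sorted_levels k b : sorted leq (levels k b).
Proof. exact: path_sorted (path_levels k b). Qed.

Lemma levels1_pos b : 0 \notin levels 1 b.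
Proof.
apply/negP=> in0; have /(order_path_min leq_trans) := path_levels 1 b.
by move/allP/(_ 0 in0).
Qed.

(** Closure under predecessors rules out jumps by more than one, so the increments of the sorted
    list are bits. *)
Lemma levels_exists k K : path leq k K ->
  {in K, forall x, k < x -> x.-1 \in k :: K} ->
  exists2 b, size b = size K & levels k b = k :: K.
Proof.
elim: K k => [|k' K IHK] k /=; first by exists [::].
case/andP=> kk' pK down; have /allP minK := order_path_min leq_trans pK.
have step : k' = k \/ k' = k.+1.
  case: (ltngtP k k') kk' => // [lt|->]; last by left.
  have := down k' (mem_head _ _) lt; rewrite !inE => /or3P[/eqP|/eqP|/minK]; lia.
have [x xK lt|b sb eb] := IHK k' pK.
  have := down x (mem_behead (s := k' :: K) xK) (leq_ltn_trans kk' lt).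
  rewrite !inE => /or3P[/eqP xk|->|->]; rewrite ?orbT //.
  by apply/orP; left; lia.
exists ((k' == k.+1) :: b); rewrite /= ?sb //; congr (_ :: _).
by rewrite -eb; congr levels; lia.
Qed.

Lemma hts_profile n (M : edges n.+1) : M \in matchings n.+1 ->
  exists b : n.-tuple bool, perm_eq (hts M) (profile (levels 1 b)).
Proof.
move=> MM; have [h0 step] := ht_walk MM.
have [K [permK K0 Kdown _]] := walk_profile (ht0 M) step.
rewrite h0 cats0 -/(hts M) in permK.
have permS : perm_eq (sort leq K) K by rewrite perm_sort.
have sS : size (sort leq K) = n.+1.
  have := perm_size permK; rewrite size_hts size_sort /= size_cat size_map; lia.
have := sort_sorted leq_total K; move: sS permS; case: (sort leq K) => // k L [sL] permS.
move=> /= pL; have /allP minL := order_path_min leq_trans pL.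
(* The least level is positive, and if it exceeded 1 its predecessor would be a smaller one. *)
have k1 : k = 1.
  have kK : k \in K by rewrite -(perm_mem permS) mem_head.
  have : k != 0 by apply: contraNneq K0 => <-.
  case: (ltngtP k 1) => // [|k1 _]; first by lia.
  have := Kdown k kK k1; rewrite -(perm_mem permS) inE => /orP[/eqP|/minL]; lia.
subst k; have [x xL x1|b sb eb] := levels_exists pL.
  rewrite (perm_mem permS) Kdown // -(perm_mem permS) inE xL orbT //.
exists (Tuple (introT eqP (etrans sb sL))); rewrite /= eb.
apply: perm_trans permK _; rewrite perm_sym /profile perm_cons.
by apply: perm_cat; rewrite ?perm_map.
Qed.

(** The multiplicity of [h] in the profile involves only those of [h] and [h.+1] in [K], so the
    latter are determined successively from level 0, which is absent. *)
Lemma perm_profile K L : 0 \notin K -> 0 \notin L ->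
  perm_eq (profile K) (profile L) -> perm_eq K L.
Proof.
move=> K0 L0 /permP eqp.
have countP J h : 0 \notin J ->
    count_mem h (profile J) = (h == 0) + count_mem h J + count_mem h.+1 J.
  move=> J0; rewrite /= count_cat count_map eq_sym addnA; congr (_ + _).
  apply: eq_in_count => x xJ /=; case: x xJ => [|x] //= xJ.
  by rewrite xJ in J0.
apply/allP=> h _ /=; apply/eqP; elim: h => [|h IHh].
  by rewrite (count_memPn K0) (count_memPn L0).
by have := eqp (pred1 h); rewrite !countP // IHh => /addnI.
Qed.

Lemma profile_levels_inj b c :
  perm_eq (profile (levels 1 b)) (profile (levels 1 c)) -> b = c.
Proof.
move/(perm_profile (levels1_pos b) (levels1_pos c)) => eqL.
apply: (@levels_inj 1); apply: (sorted_eq leq_trans anti_leq) => //;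
  exact: sorted_levels.
Qed.

(** * Realizing all the pairs (crossing number, heights) *)

(** An up-step of level [k'] is inserted at gap [k'.-1], which must lie among the [k] initial
    openers. *)
Definition up_step (k k' : nat) := 0 < k' <= k.+1.

Lemma up_path_pos k K : path up_step k K -> size K <= sumn K.
Proof. by elim: K k => //= a K IHK k /andP[/andP[a0 _] /IHK]; lia. Qed.

Lemma last_up_path k K : path up_step k K -> last k K <= k + size K.
Proof. by elim: K k => [|a K IHK] k /=; [lia | case/andP=> /andP[_ ak] /IHK; lia]. Qed.

Lemma path_up_levels k b : path up_step k (levels k.+1 b).
Proof.
elim: b k => [|x b IHb] k /=; rewrite /up_step ?leqnn //= .
case: x; rewrite ?addn1 ?addn0; first exact: IHb.
have := IHb k; case: b {IHb} => [|y b] /=; rewrite /up_step; first by lia.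
by move=> /andP[_ ->]; rewrite andbT; lia.
Qed.

(* The induction keeps the first [last 0 K] vertices openers: inserting an edge
   from the gap [p <= q] to the gap [q] among them adds an up-step at level
   [q.+1] and crosses exactly [q - p] edges. *)
Lemma matching_exists n K c : size K = n -> path up_step 0 K -> c + n <= sumn K ->
  exists M : edges n, [/\ M \in matchings n, cr M = c, perm_eq (hts M) (profile K),
    forall i, i <= last 0 K -> ht M i = i & {in M, forall B, last 0 K <= maxv B}].
Proof.
elim/last_ind: K n c => [|K k' IHK] n c sK pK cK.
  rewrite -sK; have c0 : c = 0 by move: cK; rewrite /= -sK; lia.
  exists set0; split.
  - rewrite inE; apply/andP; split; last by apply/forall_inP=> B; rewrite inE.
    apply/and3P; split; rewrite ?inE //.
      by apply/eqP/setP=> -[].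
    by apply/trivIsetP=> A B; rewrite inE.
  - by rewrite crE big_set0.
  - by rewrite /hts /= ht0.
  - by move=> i; rewrite leqn0 => /eqP->; rewrite ht0.
  - by move=> B; rewrite inE.
move: sK pK cK; rewrite size_rcons rcons_path sumn_rcons last_rcons => <- /andP[pK].
case: k' => // q /andP[_ qk] cK {n}; rewrite ltnS in qk.
set k := last 0 K in qk *; set m := size K.
have km : k <= m := last_up_path pK.
have sumK : m <= sumn K := up_path_pos pK.
(* Greedy choice: the new edge takes [minn c q] of the crossings and [M] realizes the rest. *)
have cK0 : c - minn c q + m <= sumn K by lia.
have [M [MM crM permM htM maxM]] := IHK m (c - minn c q) erefl pK cK0.
have pP : q - minn c q < m.*2.+2 by lia.
have qP : q < m.*2.+1 by lia.
pose p' := Ordinal pP; pose q' := Ordinal qP.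
have pq : p' <= q' by rewrite /=; lia.
exists (insert_edge M p' q'); split.
- exact: insert_edge_matching.
(* No old edge closes before vertex [k], and [q <= k]; so [cr_insert] applies, with heights [p'] and
   [q'] at the two gaps. *)
- have : forall B, B \in M -> ~~ [&& minv B < p', p' <= maxv B & maxv B < q'].
    by move=> B /maxM; rewrite /= -/k; lia.
  move/(cr_insert MM pq); rewrite crM (htM q') // (htM p') -/k; last by rewrite /=; lia.
  by rewrite /=; move: (cr _) => C; lia.
- rewrite hts_insert // catA.
  have idE s : {in s, forall g, g <= q} -> [seq ht M g | g <- s] = s.
    by move=> sq; rewrite -[RHS]map_id; apply/eq_in_map=> g /sq gq; rewrite htM -/k; lia.
  (* The initial heights being 0, ..., [q], the choice of [p'] leaves no trace: the net gain is one
     [q] and one [q.+1]. *)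
  have -> : [seq ht M g | g <- iota 0 p'.+1] ++ [seq (ht M g).+1 | g <- iota p' (q' - p').+1]
      = iota 0 q ++ [:: q; q.+1].
    rewrite (map_comp S (ht M)) !idE; try by move=> g; rewrite mem_iota /=; lia.
    rewrite -(eq_map add1n) -iotaDl add1n -[p'.+1 in X in _ ++ X]add0n -iotaD.
    by rewrite (_ : p'.+1 + _ = q + 2) ?iotaD //=; lia.
  have htsE : hts M = iota 0 q ++ [seq ht M g | g <- iota q (m.*2.+1 - q)].
    rewrite -[in RHS](idE (iota 0 q)); last by move=> g; rewrite mem_iota; lia.
    by rewrite -map_cat -{2}[q]add0n -iotaD subnKC // ltnW.
  apply/permP=> a; have := permP permM a.
  rewrite htsE /profile map_rcons -!cats1 /= !count_cat /=; lia.
- move=> i iq; rewrite ht_insert //=.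
  by case: leqP => ip; [|case: ifP => iq']; rewrite htM -/k; lia.
- move=> B; rewrite in_setU1 => /orP[/eqP->|/imsetP[B0 B0M ->]].
    by rewrite maxv_new_edge.
  rewrite maxv_insert ?(matching_card2 MM) //=; have := maxM B0 B0M; rewrite -/k => kB.
  by rewrite (leq_trans qk kB) addn1 ltnS (leq_trans qk) // (leq_trans kB) // leq_addr.
Qed.

(** * Counting the classes *)

Lemma card_equivalence_partition (T U : finType) (D : {set T}) (r : rel T) (f : T -> U) :
  {in D &, forall x y, r x y = (f x == f y)} ->
  #|equivalence_partition r D| = #|f @: D|.
Proof.
move=> rE; pose g (u : U) := [set y in D | u == f y].
have -> : equivalence_partition r D = g @: (f @: D).
  rewrite -imset_comp; apply: eq_in_imset => x xD; apply/setP=> y.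
  by rewrite !inE; case: (boolP (y \in D)) => // yD; rewrite rE.
apply: card_in_imset => _ _ /imsetP[x xD ->] /imsetP[y yD ->] /setP/(_ x).
by rewrite !inE xD eqxx /= => /esym/eqP.
Qed.

Lemma sum_tupleS (n : nat) (F : n.+1.-tuple bool -> nat) :
  \sum_b F b = \sum_(x : bool) \sum_(b : n.-tuple bool) F (cons_tuple x b).
Proof.
rewrite pair_big (reindex (fun u : bool * n.-tuple bool => cons_tuple u.1 u.2)) //=.
exists (fun t => (thead t, behead_tuple t)) => [[x b] _|t _].
  by congr (_, _); apply: val_inj.
by rewrite /= [RHS]tuple_eta; apply: val_inj.
Qed.

(** Totals the maximal crossing numbers, the entries of [levels 0 b] being those of [levels 1 b]
    less one. Split on the first bit: if it is true, the [n.+1] later entries all rise by one. *)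
Lemma sum_levels n :
  (\sum_(b : n.-tuple bool) sumn (levels 0 b)).*2 = 2 ^ n * 'C(n.+1, 2).
Proof.
elim: n => [|n IHn].
  by rewrite big1 // => b _; rewrite (tuple0 b).
have sumT : \sum_(b : n.-tuple bool) sumn (levels 1 b)
    = 2 ^ n * n.+1 + \sum_(b : n.-tuple bool) sumn (levels 0 b).
  under eq_bigr => b _ do rewrite sumn_levels size_tuple mul1n.
  by rewrite big_split /= sum_nat_const card_tuple card_bool.
have stepF (b : n.-tuple bool) x : sumn (levels 0 (cons_tuple x b)) = sumn (levels x b) by [].
rewrite sum_tupleS; under eq_bigr => x _ do under eq_bigr do rewrite stepF.
rewrite big_bool [X in X.*2]/= sumT binS bin1 expnS !doubleD IHn; lia.
Qed.

(** The maximum makes the type finite; the exact range, which depends on the composition, is imposed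
    in [labels]. *)
Definition label_type n : finType :=
  (n.-tuple bool * 'I_(\max_(b : n.-tuple bool) sumn (levels 0 b)).+1)%type.

Definition labels n : {set label_type n} :=
  [set u : label_type n | u.2 <= sumn (levels 0 u.1)].

Lemma card_labels n : (#|labels n|).*2 = 2 ^ n * ('C(n.+1, 2) + 2).
Proof.
have -> : #|labels n| = \sum_(b : n.-tuple bool) (sumn (levels 0 b)).+1.
  set m := \max_(b : n.-tuple bool) sumn (levels 0 b).
  transitivity (\sum_(b : n.-tuple bool) \sum_(c < m.+1 | c <= sumn (levels 0 b)) 1).
    by rewrite pair_big_dep -sum1_card; apply: eq_bigl => u; rewrite inE.
  apply: eq_bigr => b _; rewrite -[RHS]card_ord -sum1_card.
  by rewrite [RHS](big_ord_widen m.+1 (fun=> 1)) // ltnS; apply: leq_bigmax.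
under eq_bigr => b _ do rewrite -addn1.
by rewrite big_split /= sum_nat_const card_tuple card_bool doubleD sum_levels; lia.
Qed.

Section Label.
Variable n : nat.

(** On matchings neither default is reached: [hts_profile] provides the tuple and [cr_le_hts] bounds
    [cr M]. *)
Definition label (M : edges n.+1) : label_type n :=
  (odflt [tuple of nseq n false] [pick b : n.-tuple bool | perm_eq (hts M) (profile (levels 1 b))],
   inord (cr M)).

Lemma labelP (M : edges n.+1) : M \in matchings n.+1 ->
  [/\ perm_eq (hts M) (profile (levels 1 (label M).1)),
      (label M).2 = cr M :> nat & label M \in labels n].
Proof.
move=> MM; have [b0 pb0] := hts_profile MM.
rewrite inE /label; case: pickP => [b pb|/(_ b0)]; last by rewrite pb0.
(* The profile of K sums to twice [sumn K] less [n.+1], and [sumn K] is [n.+1] plus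
   [sumn (levels 0 b)]; so [cr_le_hts] becomes this bound. *)
have crb : cr M <= sumn (levels 0 b).
  have := cr_le_hts MM; rewrite (perm_sumn pb) /profile /= sumn_cat.
  have sumP (K : seq nat) : 0 \notin K -> sumn (map predn K) + size K = sumn K.
    by elim: K => //= -[|a] K IHK; rewrite inE // => /IHK; lia.
  have := sumP _ (levels1_pos b).
  rewrite (sumn_levels 1) size_levels size_tuple.
  by move: (sumn (map _ _)) (sumn (levels 0 _)) (cr M) => p s c; lia.
rewrite inordK; first by [].
by rewrite ltnS (leq_trans crb) //; apply: leq_bigmax.
Qed.

Lemma label_imset : label @: matchings n.+1 = labels n.
Proof.
apply/setP=> -[b c]; apply/imsetP/idP => [[M /labelP[_ _]] + ->//|].
rewrite inE /= => cb.
have [|||M [MM crM permM _ _]] := @matching_exists n.+1 (levels 1 b) c.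
- by rewrite size_levels size_tuple.
- exact: path_up_levels.
- by rewrite sumn_levels size_tuple mul1n addnC leq_add2l.
exists M => //; have [perm2 cr2 _] := labelP MM.
apply/eqP; rewrite eq_sym -pair_eqE; apply/andP; split; apply/eqP; last first.
  by apply: val_inj; rewrite /= cr2.
apply/val_inj/profile_levels_inj; apply: perm_trans permM.
by rewrite perm_sym.
Qed.

Lemma card_cr_classes : #|cr_classes n.+1| = #|labels n|.
Proof.
rewrite -label_imset; apply: card_equivalence_partition => M N MM NN.
have [pM cM _] := labelP MM; have [pN cN _] := labelP NN.
apply/asboolP/eqP => [/(cr_similarP MM NN)[eq_cr eq_hts]|eq_lab].
  apply/eqP; rewrite -pair_eqE; apply/andP; split; apply/eqP; last first.
    by apply: val_inj; rewrite /= cM cN.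
  apply/val_inj/profile_levels_inj; rewrite perm_sym in pM.
  exact: perm_trans (perm_trans pM eq_hts) pN.
apply/(cr_similarP MM NN); split; first by rewrite -cM -cN eq_lab.
by apply: perm_trans pM _; rewrite eq_lab perm_sym.
Qed.

End Label.

Import GRing.Theory.
Local Open Scope ring_scope.

Theorem theorem3p3 (n : nat) (n_gt0 : (0 < n)%N) :
  #|cr_classes n|%:R = 2%:R ^ (n%:Z - 2%:Z) * ('C(n, 2)%:R + 2%:R) :> rat.
Proof.
case: n n_gt0 => // n _; rewrite card_cr_classes.
have -> : n.+1%:Z - 2%:Z = n%:Z - 1 by lia.
rewrite expfzDr // exprN1 -exprnP.
(* Doubling matches [card_labels] and clears the exponent, which is -1 for a single edge. *)
apply: (@mulfI _ 2%:R) => //.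
rewrite -natrM mul2n card_labels natrM natrD natrX.
by field.
Qed.
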